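(* Let $\mu_1=\mu_2=0$, $a_{12}=1$, and either ($a_{11}=1$ and $a_{22}=a\neq 1$) or ($a_{11}=a\neq 1$ and $a_{22}=1$), where $a>0$ (one variance changes). Then the sensitivities $H_1$ and $H_2$ of the two projections (as defined in the context) satisfy: (i) For any $|\rho|\in(0,1)$ and $a>1$ (variance increase), $H_2>H_1$. (ii) When $|\rho|\in(0,1)$ and $a\in(0,1)$ (variance decrease), $H_2<H_1$ in most cases. The only exception is if $|\rho|\in(\sqrt3/2,1)$ and $a\in\bigl(0,\sqrt{4\rho^2-3}\bigr)$, where $H_2>H_1$. That is, $H_2>H_1$ for all such $(\rho,a)$, and $H_2<H_1$ for all other $|\rho|\in(0,1)$, $a\in(0,1)$.
   Context: Bivariate change setting. The pre-change mean is $\boldsymbol{\mu}_0=\mathbf 0\in\mathbb{R}^2$ and the post-change mean is $\boldsymbol{\mu}_1=(\mu_1,\mu_2)^\top$. The pre- and post-change covariance matrices are $$\boldsymbol{\Sigma}_0=\begin{pmatrix}1&\rho\\ \rho&1\end{pmatrix},\qquad \boldsymbol{\Sigma}_1=\begin{pmatrix}a_{11}^2& a_{11}a_{22}a_{12}\rho\\ a_{11}a_{22}a_{12}\rho& a_{22}^2\end{pmatrix},$$ where $-1<\rho<1$, $\rho\neq 0$, $-1<a_{12}\rho<1$; $a_{11},a_{22}$ are multiplicative change factors of the standard deviations and $a_{12}$ is the multiplicative change factor of the correlation. Let $(\lambda_j,\mathbf v_j)_{j=1,2}$ be the eigenvalues and normalized (unit) eigenvectors of $\boldsymbol{\Sigma}_0$,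 ordered so that $\lambda_1\ge\lambda_2$. For $j=1,2$ let $p_j$ be the density of the normal distribution with mean $\mathbf v_j^\top\boldsymbol{\mu}_0=0$ and variance $\mathbf v_j^\top\boldsymbol{\Sigma}_0\mathbf v_j=\lambda_j$, and let $q_j$ be the density of the normal distribution with mean $\mathbf v_j^\top\boldsymbol{\mu}_1$ and variance $\mathbf v_j^\top\boldsymbol{\Sigma}_1\mathbf v_j$. The sensitivity of the $j$-th projection is $H_j=H(p_j,q_j)\ge 0$, where $H$ is the Hellinger distance; for normal densities $p,q$ with means $\xi_1,\xi_2$ and standard deviations $\sigma_1,\sigma_2>0$, $$H^2(p,q)=1-\sqrt{\frac{2\sigma_1\sigma_2}{\sigma_1^2+\sigma_2^2}}\,\exp\left\{-\frac14\,\frac{(\xi_1-\xi_2)^2}{\sigma_1^2+\sigma_2^2}\right\}.$$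
   Formalization: In (ii), ''H_2<H_1 for all other |ρ|∈(0,1), a∈(0,1)'' fails on the curve |ρ|∈(√3/2,1), a=√(4ρ²−3), where H_2=H_1 (e.g. ρ²=13/16, a=1/2); the formal theorem excludes this curve from that claim and states H_2=H_1 on it. *)

(* Defs.v *)
From HB Require Import structures.
From mathcomp Require Import all_boot all_order all_algebra.
From mathcomp Require Import all_classical all_reals all_analysis.
Set Implicit Arguments.
Unset Strict Implicit.
Unset Printing Implicit Defensive.
Import Order.TTheory GRing.Theory Num.Theory.
Local Open Scope ring_scope.

Definition pre_change_cov (R : realType) (rho : R) : 'M[R]_2 :=
  \matrix_(i, j) (if i == j then 1 else rho).

Definition post_change_mean (R : realType) (m1 m2 : R) : 'cV[R]_2 :=
  \col_i (if i == 0 then m1 else m2).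

Definition post_change_cov (R : realType) (a11 a22 a12 rho : R) : 'M[R]_2 :=
  \matrix_(i, j)
    (if i == j then (if i == 0 then a11 ^+ 2 else a22 ^+ 2)
     else a11 * a22 * a12 * rho).

(* The [lam j] are the eigenvalues of [S] counted with multiplicity (hence the
   characteristic polynomial), in nonincreasing order, and each [v j] is a
   Euclidean unit eigenvector for [lam j].  Orthogonality of the [v j] is not
   required: for symmetric [S] it is automatic when the [lam j] are distinct. *)
Definition ordered_eigenpairs (R : realType) (n : nat) (S : 'M[R]_n)
    (lam : 'I_n -> R) (v : 'I_n -> 'cV[R]_n) : Prop :=
  [/\ char_poly S = \prod_(j < n) ('X - (lam j)%:P),
      forall j, S *m v j = lam j *: v j,
      forall j, Num.sqrt (\sum_(i < n) v j i 0 ^+ 2) = 1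
    & forall i j : 'I_n, (i <= j)%N -> lam j <= lam i].

Definition hellinger (R : realType) (p q : R -> R) : R :=
  Num.sqrt (2^-1 *
    Rintegral lebesgue_measure setT
      (fun x => (Num.sqrt (p x) - Num.sqrt (q x)) ^+ 2)).

Definition projected_mean (R : realType) (n : nat)
    (mu : 'cV[R]_n) (v : 'cV[R]_n) : R := (v^T *m mu) 0 0.

Definition projected_var (R : realType) (n : nat)
    (S : 'M[R]_n) (v : 'cV[R]_n) : R := (v^T *m S *m v) 0 0.

(* The scale argument of [normal_pdf] is the standard deviation. *)
Definition projected_pdf (R : realType) (n : nat)
    (mu : 'cV[R]_n) (S : 'M[R]_n) (v : 'cV[R]_n) : R -> R :=
  normal_pdf (projected_mean mu v) (Num.sqrt (projected_var S v)).

Definition sensitivity (R : realType) (n : nat)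
    (mu0 : 'cV[R]_n) (S0 : 'M[R]_n) (mu1 : 'cV[R]_n) (S1 : 'M[R]_n)
    (v : 'cV[R]_n) : R :=
  hellinger (projected_pdf mu0 S0 v) (projected_pdf mu1 S1 v).

(* Main.v *)
Require Import Defs.
From HB Require Import structures.
From mathcomp Require Import all_boot all_order all_algebra.
From mathcomp Require Import all_classical all_reals all_analysis.
From mathcomp Require Import ring lra.
Import Order.TTheory GRing.Theory Num.Theory.
Local Open Scope ring_scope.

(* The eigenvalues of the pre-change covariance are [1 + r] and [1 - r] with
   [r = |rho|], and [v_j^T Sigma_1 v_j = (1 + a^2)/2 + a (lam_j - 1)].  Writing
   [V_j] and [W_j] for the pre- and post-change projected variances, [H_j]
   decreases with [V_j W_j / (V_j + W_j)^2], so [H_1 < H_2] iff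
   [V_2 W_2 (V_1 + W_1)^2 < V_1 W_1 (V_2 + W_2)^2].  The difference of the two
   sides factors as [(V_1 W_2 - V_2 W_1) (W_1 W_2 - V_1 V_2)], where
   [V_1 W_2 - V_2 W_1 = r (1 - a)^2 > 0] and
   [4 (W_1 W_2 - V_1 V_2) = (a^2 - 1) (a^2 + 3 - 4 r^2)]. *)

Lemma horner_char_poly2 (R : comNzRingType) (S : 'M[R]_2) (x : R) :
  (char_poly S).[x] = (x - S 0 0) * (x - S 1 1) - S 0 1 * S 1 0.
Proof.
rewrite /char_poly (expand_det_row _ 0) !big_ord_recl !big_ord0 /cofactor.
rewrite !det_mx11 !mxE /= !hornerE /=.
have -> : lift 0 0 = 1 :> 'I_2 by exact/val_inj.
have -> : lift 1 0 = 0 :> 'I_2 by exact/val_inj.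
by rewrite -[ord0]/(0 : 'I_2); ring.
Qed.

(** Evaluating the characteristic polynomial at 0 and 1 gives [lam 0 + lam 1 = 2] and
    [(lam 0 - 1) ^+ 2 = rho ^+ 2]; the ordering then fixes the sign of the root. *)
Lemma ordered_eigenpairs_eigenvalues {R : realType} {rho : R}
    {lam : 'I_2 -> R} {v : 'I_2 -> 'cV[R]_2} :
  ordered_eigenpairs (pre_change_cov rho) lam v ->
  lam 0 = 1 + `|rho| /\ lam 1 = 1 - `|rho|.
Proof.
move=> [hchar _ _ /(_ 0 1 isT) hle].
have hp x : (x - 1) * (x - 1) - rho * rho = (x - lam 0) * (x - lam 1).
  have := congr1 (horner^~ x) hchar.
  rewrite horner_char_poly2 !mxE /= => ->.
  rewrite !big_ord_recl big_ord0 mulr1 !hornerE.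
  by have -> : lift 0 0 = 1 :> 'I_2 by exact/val_inj.
have tr : lam 0 + lam 1 = 2 by have := hp 0; have := hp 1; lra.
have hr : `|rho| = lam 0 - 1.
  rewrite -[RHS]ger0_norm; last by lra.
  rewrite -!sqrtr_sqr; congr (Num.sqrt _).
  by have := hp 1; have -> : lam 1 = 2 - lam 0 by [lra]; nra.
by split; lra.
Qed.

Lemma projected_var2 (R : realType) (S : 'M[R]_2) (v : 'cV[R]_2) :
  projected_var S v = S 0 0 * v 0 0 ^+ 2 + (S 0 1 + S 1 0) * (v 0 0 * v 1 0)
    + S 1 1 * v 1 0 ^+ 2.
Proof.
rewrite /projected_var !mxE !big_ord_recl !big_ord0 !mxE.
rewrite !big_ord_recl !big_ord0 !mxE /=.
have -> : lift 0 0 = 1 :> 'I_2 by exact/val_inj.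
by ring.
Qed.

Lemma ordered_eigenpairs_unit {R : realType} {n : nat} {S : 'M[R]_n}
    {lam : 'I_n -> R} {v : 'I_n -> 'cV[R]_n} :
  ordered_eigenpairs S lam v -> forall j, \sum_(i < n) v j i 0 ^+ 2 = 1.
Proof.
move=> [_ _ hunit _] j.
rewrite -[LHS]sqr_sqrtr ?hunit ?expr1n// sumr_ge0// => i _.
exact: sqr_ge0.
Qed.

Lemma projected_pre_change_cov {R : realType} {rho : R}
    {lam : 'I_2 -> R} {v : 'I_2 -> 'cV[R]_2} :
  ordered_eigenpairs (pre_change_cov rho) lam v ->
  forall j, projected_var (pre_change_cov rho) (v j) = lam j.
Proof.
move=> heig0 j; have hunit := ordered_eigenpairs_unit heig0 j.
case: heig0 => _ heig _ _.
rewrite /projected_var -mulmxA heig -scalemxAr !mxE.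
under eq_bigr do rewrite mxE -expr2.
by rewrite hunit mulr1.
Qed.

(** Since [rho != 0], the eigenvectors lie on the two diagonals: both squared coordinates are 1/2,
    so [a11] and [a22] enter symmetrically. *)
Lemma projected_post_change_cov {R : realType} {rho : R} (a11 a22 : R)
    {lam : 'I_2 -> R} {v : 'I_2 -> 'cV[R]_2} :
  rho != 0 -> ordered_eigenpairs (pre_change_cov rho) lam v ->
  forall j, projected_var (post_change_cov a11 a22 1 rho) (v j) =
    (a11 ^+ 2 + a22 ^+ 2) / 2 + a11 * a22 * (lam j - 1).
Proof.
move=> rho0 heig0 j; have [l0 l1] := ordered_eigenpairs_eigenvalues heig0.
have hl : (lam j - 1) ^+ 2 = rho ^+ 2.
  case: j => -[|[|//]] k.
  - have -> : Ordinal k = 0 by exact/val_inj.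
    by rewrite l0 -[rho ^+ 2]real_normK ?num_real//; ring.
  - have -> : Ordinal k = 1 by exact/val_inj.
    by rewrite l1 -[rho ^+ 2]real_normK ?num_real//; ring.
have hq := projected_pre_change_cov heig0 j.
rewrite !projected_var2 !mxE /= in hq *.
have := ordered_eigenpairs_unit heig0 j.
case: heig0 => _ /(_ j) heig _ _.
have := congr1 (fun M : 'cV_2 => M 0 0) heig.
rewrite !mxE !big_ord_recl !big_ord0 !mxE /=.
rewrite -[ord0]/(0 : 'I_2); have -> : lift 0 0 = 1 :> 'I_2 by exact/val_inj.
move: (v j 0 0) (v j 1 0) hq => x y hq e0 hxy.
(* The first row of the eigenvector equation reads [rho * y = (lam j - 1) * x]; square it and use
   [hl]. *)
have hy : rho ^+ 2 * y ^+ 2 = rho ^+ 2 * x ^+ 2.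
  by rewrite -{2}hl -!exprMn; congr (_ ^+ 2); lra.
have {}hy : y ^+ 2 = x ^+ 2 by apply: mulfI hy; rewrite expf_neq0.
have -> : lam j - 1 = 2 * rho * (x * y) by lra.
have -> : x ^+ 2 = 2^-1 by lra.
have -> : y ^+ 2 = 2^-1 by lra.
by field.
Qed.

(** Expand the square under the integral: both densities have mass 1, and the cross term is a
    constant [c] times a normal density, so the squared distance is [1 - c]. *)
Lemma hellinger_normal (R : realType) (m s1 s2 : R) : 0 < s1 -> 0 < s2 ->
  hellinger (normal_pdf m s1) (normal_pdf m s2) =
  Num.sqrt (1 - Num.sqrt (2 * s1 * s2 / (s1 ^+ 2 + s2 ^+ 2))).
Proof.
move=> s10 s20.
(* [t] is the standard deviation of the normal density proportional to the
   geometric mean of the two given ones: [2 / t^2 = 1 / s1^2 + 1 / s2^2]. *)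
set t := Num.sqrt (2 * (s1 * s2) ^+ 2 / (s1 ^+ 2 + s2 ^+ 2)).
have den0 : 0 < s1 ^+ 2 + s2 ^+ 2 by rewrite addr_gt0// exprn_gt0.
have t0 : 0 < t.
  by rewrite sqrtr_gt0 divr_gt0// mulr_gt0// exprn_gt0// mulr_gt0.
have tE : t ^+ 2 = 2 * (s1 * s2) ^+ 2 / (s1 ^+ 2 + s2 ^+ 2).
  by rewrite sqr_sqrtr// divr_ge0// ?(ltW den0)// mulr_ge0// sqr_ge0.
set c := Num.sqrt (2 * s1 * s2 / _).
have sqrt_pdfM x :
    Num.sqrt (normal_pdf m s1 x) * Num.sqrt (normal_pdf m s2 x) =
    c * normal_pdf m t x.
  have c0 : 0 <= c by exact: sqrtr_ge0.
  rewrite -sqrtrM ?normal_pdf_ge0// -[RHS]ger0_norm; last first.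
    by rewrite mulr_ge0 ?normal_pdf_ge0.
  rewrite -sqrtr_sqr; congr (Num.sqrt _).
  rewrite !normal_pdfE ?gt_eqF// mulrACA.
  have -> : normal_fun m s1 x * normal_fun m s2 x = normal_fun m t x ^+ 2.
    rewrite /normal_fun -expRD -expRM_natl tE; congr expR.
    by field; rewrite !gt_eqF.
  rewrite !exprMn [RHS]mulrA; congr (_ * _).
  (* With [s] taken out of the root, the constants reduce to [c ^+ 2 / t ^+ 2 = 1 / (s1 * s2)]. *)
  have peakE s : 0 < s -> normal_peak s = (Num.sqrt (pi *+ 2))^-1 / s.
    move=> s0; rewrite /normal_peak -mulrnAr sqrtrM ?sqr_ge0// sqrtr_sqr.
    by rewrite gtr0_norm// invfM mulrC.
  rewrite !peakE// !exprMn !exprVn tE /c sqr_sqrtr; last first.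
    by rewrite divr_ge0 ?(ltW den0)// !mulr_ge0// ltW.
  have k0 : 0 < Num.sqrt (pi *+ 2) :> R by rewrite sqrtr_gt0 mulrn_wgt0// pi_gt0.
  by field; rewrite !gt_eqF.
have int s : lebesgue_measure.-integrable setT (EFin \o normal_pdf m s).
  exact: integrable_normal_pdf.
have intc : lebesgue_measure.-integrable setT
    (EFin \o (fun x => 2 * c * normal_pdf m t x)).
  by have := integrableZl measurableT (2 * c) (int t).
have intE s : Rintegral lebesgue_measure setT (normal_pdf m s) = 1.
  by rewrite /Rintegral integral_normal_pdf.
rewrite /hellinger; congr (Num.sqrt _).
transitivity (2^-1 * Rintegral lebesgue_measure setT
    (normal_pdf m s1 \- (fun x => 2 * c * normal_pdf m t x) \+ normal_pdf m s2)).
  congr (_ * _); apply: eq_Rintegral => x _ /=.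
  rewrite sqrrB -mulr_natl sqrt_pdfM mulrA.
  by rewrite !sqr_sqrtr ?normal_pdf_ge0.
rewrite RintegralD//; last exact: (integrableB measurableT (int s1) intc).
rewrite RintegralB// RintegralZl// !intE.
by field.
Qed.

Lemma ltr_hellinger_normal (R : realType) (m x y x' y' : R) :
  0 < x -> 0 < y -> 0 < x' -> 0 < y' ->
  (hellinger (normal_pdf m (Num.sqrt x)) (normal_pdf m (Num.sqrt y)) <
   hellinger (normal_pdf m (Num.sqrt x')) (normal_pdf m (Num.sqrt y'))) =
  (x' * y' * (x + y) ^+ 2 < x * y * (x' + y') ^+ 2).
Proof.
move=> x0 y0 x'0 y'0.
have xy0 : 0 < x + y by exact: addr_gt0.
have xy'0 : 0 < x' + y' by exact: addr_gt0.
rewrite !hellinger_normal ?sqrtr_gt0//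
  !sqr_sqrtr ?(ltW x0) ?(ltW y0) ?(ltW x'0) ?(ltW y'0)//.
(* By the AM-GM inequality the outer radicand is nonnegative; [Num.sqrt] is 0 on negative reals, so
   strict comparison of roots would otherwise fail. *)
have affinity_le1 (u w : R) : 0 < u -> 0 < w ->
    Num.sqrt (2 * Num.sqrt u * Num.sqrt w / (u + w)) <= 1.
  move=> u0 w0; rewrite -[leRHS]sqrtr1 ler_wsqrtr//.
  rewrite ler_pdivrMr ?addr_gt0// mul1r.
  have := sqr_ge0 (Num.sqrt u - Num.sqrt w).
  by rewrite sqrrB (sqr_sqrtr (ltW u0)) (sqr_sqrtr (ltW w0)); lra.
have ltr_sqrt_ge0 (u w : R) : 0 <= u -> 0 <= w ->
    (Num.sqrt u < Num.sqrt w) = (u < w).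
  by move=> u0 w0; rewrite -(@ltr_pXn2r _ 2)// ?nnegrE// !sqr_sqrtr.
have affinity_ge0 (u w : R) : 0 < u -> 0 < w ->
    0 <= 2 * Num.sqrt u * Num.sqrt w / (u + w).
  by move=> u0 w0; rewrite divr_ge0 ?(ltW (addr_gt0 u0 w0))// !mulr_ge0.
rewrite ltr_sqrt_ge0 ?subr_ge0 ?affinity_le1// ltrD2l ltrN2.
rewrite ltr_sqrt_ge0 ?affinity_ge0// -(@ltr_pXn2r _ 2)// ?nnegrE ?affinity_ge0//.
rewrite !exprMn !exprVn.
rewrite !sqr_sqrtr ?(ltW x0) ?(ltW y0) ?(ltW x'0) ?(ltW y'0)//.
rewrite ltr_pdivrMr ?exprn_gt0//.
rewrite [ltRHS]mulrAC ltr_pdivlMr ?exprn_gt0// -!mulrA.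
by rewrite !ltr_pM2l ?ltr0n// !mulrA.
Qed.

(** Here [s] stands for [lam j - 1], so [h r] and [h (- r)] are the two sensitivities. Having both
    strict comparisons also yields equality when [disc] vanishes. *)
Lemma ltr_hellinger_one_variance {R : realType} {r a : R} :
  0 < r < 1 -> 0 < a -> a != 1 ->
  let h s := hellinger (normal_pdf 0 (Num.sqrt (1 + s)))
    (normal_pdf 0 (Num.sqrt ((1 + a ^+ 2) / 2 + a * s))) in
  let disc := (a ^+ 2 - 1) * (a ^+ 2 + 3 - 4 * r ^+ 2) in
  (h r < h (- r)) = (0 < disc) /\ (h (- r) < h r) = (disc < 0).
Proof.
move=> /andP[r0 r1] a0 a1 /=.
set V := 1 + r; set V' := 1 - r; set disc := _ * (_ - _).
set W := (1 + a ^+ 2) / 2 + a * r; set W' := (1 + a ^+ 2) / 2 + a * - r.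
have V0 : 0 < V by rewrite /V; lra.
have V'0 : 0 < V' by rewrite /V'; lra.
have W0 : 0 < W.
  have := mulr_gt0 a0 r0; have := sqr_ge0 a.
  by rewrite /W; lra.
(* Write [W'] as [(1 - a) ^+ 2 / 2 + a * V']. *)
have W'0 : 0 < W'.
  have := mulr_gt0 a0 V'0; have := sqr_ge0 (1 - a).
  by rewrite /W' /V' sqrrB; lra.
have c0 : 0 < r * (1 - a) ^+ 2 / 4.
  by rewrite divr_gt0// mulr_gt0// exprn_even_gt0//= subr_eq0 eq_sym.
have keyE : V * W * (V' + W') ^+ 2 - V' * W' * (V + W) ^+ 2 =
    r * (1 - a) ^+ 2 / 4 * disc.
  by rewrite /W /W' /V /V' /disc; field.
split; rewrite ltr_hellinger_normal//.
  by rewrite -subr_gt0 keyE (pmulr_rgt0 _ c0).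
by rewrite -subr_lt0 keyE (pmulr_rlt0 _ c0).
Qed.

Lemma sqrt3_half_lt {R : realType} {r : R} :
  0 < r -> (Num.sqrt 3 / 2 < r) = (3 < 4 * r ^+ 2).
Proof.
move=> r0; rewrite ltr_pdivrMr// -(@ltr_pXn2r _ 2)// ?nnegrE ?sqrtr_ge0//;
    last first.
  by rewrite mulr_ge0// ltW.
by rewrite sqr_sqrtr// exprMn mulrC expr2 -natrM.
Qed.

Theorem proposition3 (R : realType) (rho a m1 m2 a11 a22 a12 : R)
    (lam : 'I_2 -> R) (v : 'I_2 -> 'cV[R]_2)
    (hrho : -1 < rho < 1) (hrho0 : rho <> 0) (ha12rho : -1 < a12 * rho < 1)
    (heig : ordered_eigenpairs (pre_change_cov rho) lam v)
    (hm1 : m1 = 0) (hm2 : m2 = 0) (ha12 : a12 = 1)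
    (ha : 0 < a) (ha1 : a <> 1)
    (hchange : (a11 = 1 /\ a22 = a) \/ (a11 = a /\ a22 = 1)) :
  let H := fun j : 'I_2 =>
    sensitivity 0 (pre_change_cov rho)
      (post_change_mean m1 m2) (post_change_cov a11 a22 a12 rho) (v j) in
  let H1 := H 0 in
  let H2 := H 1 in
  let exceptional :=
    Num.sqrt 3 / 2 < `|rho| < 1 /\ 0 < a < Num.sqrt (4 * rho ^+ 2 - 3) in
  let boundary :=
    Num.sqrt 3 / 2 < `|rho| < 1 /\ a = Num.sqrt (4 * rho ^+ 2 - 3) in
  (1 < a -> H1 < H2) /\
  (a < 1 ->
    [/\ exceptional -> H1 < H2,
        ~ exceptional -> ~ boundary -> H2 < H1
      & boundary -> H2 = H1]).
Proof.
move=> H H1 H2 exceptional boundary.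
have hr0 : 0 < `|rho| by rewrite normr_gt0; exact/eqP.
have hr1 : `|rho| < 1 by rewrite ltr_norml.
have hV0 := projected_pre_change_cov heig.
have hV1 := projected_post_change_cov a11 a22 (introN eqP hrho0) heig.
(* Both alternatives of [hchange] give the same symmetric functions of [a11] and [a22], so they need
   no separate treatment. *)
have [hA1 hA2] : a11 ^+ 2 + a22 ^+ 2 = 1 + a ^+ 2 /\ a11 * a22 = a.
  by case: hchange => [[-> ->]|[-> ->]]; split; ring.
have HE j s : lam j = 1 + s -> H j = hellinger (normal_pdf 0 (Num.sqrt (1 + s)))
    (normal_pdf 0 (Num.sqrt ((1 + a ^+ 2) / 2 + a * s))).
  move=> ls; rewrite /H /sensitivity /projected_pdf hV0 ha12 hV1 hA1 hA2 ls.
  have -> : post_change_mean m1 m2 = 0.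
    by rewrite hm1 hm2; apply/matrixP => i k; rewrite !mxE if_same.
  by rewrite /projected_mean mulmx0 mxE addrAC subrr add0r.
have [l0 l1] := ordered_eigenpairs_eigenvalues heig.
rewrite /H1 /H2 (HE _ _ l0) (HE _ _ l1) /exceptional /boundary.
have -> : rho ^+ 2 = `|rho| ^+ 2 by rewrite real_normK ?num_real.
have hr : 0 < `|rho| < 1 by rewrite hr0.
have [] := ltr_hellinger_one_variance hr ha (introN eqP ha1).
move: (hellinger _ _) (hellinger _ _) => h1 h2 lt12 lt21.
move: `|rho| hr0 hr1 lt12 lt21 => r hr0 hr1 lt12 lt21.
rewrite (sqrt3_half_lt hr0) hr1 ha andbT /=.
clear -hr0 hr1 ha lt12 lt21.
have r2_lt1 : r ^+ 2 < 1 by rewrite expr_lt1// ltW.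
split=> [a_gt1|a_lt1].
  (* Both factors are positive, as [a ^+ 2 + 3 > 4 > 4 * r ^+ 2]. *)
  have a2_gt1 : 1 < a ^+ 2 by rewrite expr_gt1// ltW.
  by rewrite lt12 mulr_gt0//; lra.
have a2_lt1 : a ^+ 2 - 1 < 0 by rewrite subr_lt0 expr_lt1// ltW.
rewrite lt12 lt21 (nmulr_rgt0 _ a2_lt1) (nmulr_rlt0 _ a2_lt1).
have lt_sqrt : 3 < 4 * r ^+ 2 ->
    (a < Num.sqrt (4 * r ^+ 2 - 3)) = (a ^+ 2 < 4 * r ^+ 2 - 3).
  move=> h; rewrite -(@ltr_pXn2r _ 2)// ?nnegrE ?sqrtr_ge0 ?(ltW ha)//.
  by rewrite sqr_sqrtr// subr_ge0 ltW.
split=> [[h3]|hne hnb|[h3 aE]].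
- by rewrite lt_sqrt//; lra.
(* If [4 * r ^+ 2 <= 3], the second factor is at least [a ^+ 2 > 0]. Otherwise [hne] and [hnb]
   exclude that it is negative or zero. *)
- have [h3|h3] := ltP 3 (4 * r ^+ 2); last by have := exprn_gt0 2 ha; lra.
  have : ~~ (a ^+ 2 < 4 * r ^+ 2 - 3).
    by apply/negP => h; apply: hne; rewrite lt_sqrt.
  rewrite -leNgt le_eqVlt => /orP[/eqP aE|]; last by lra.
  by case: hnb; split=> //; rewrite aE sqrtr_sqr gtr0_norm.
(* On this curve the second factor is zero, so neither strict inequality holds. *)
- have a2E : a ^+ 2 = 4 * r ^+ 2 - 3 by rewrite aE sqr_sqrtr//; lra.
  apply/eqP; rewrite eq_le !leNgt lt12 lt21.
  rewrite (nmulr_rgt0 _ a2_lt1) (nmulr_rlt0 _ a2_lt1).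
  by rewrite a2E subrK subrr ltxx.
Qed.
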